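(* Let $\mathcal{C}$ be any nonempty class of subsets of Polish spaces that is closed under forming complements, countable unions and preimages with respect to Borel-measurable functions, and such that all subsets of the Baire space ${}^\omega\omega$ in $\mathcal{C}$ are determined. Then the restriction of $\preceq$ to the class of subsets of $\mathbb{R}$ in $\mathcal{C}$ satisfies the $\mathsf{SLO}$ principle and is well-founded.
   Context: A function $f\colon\mathbb{R}\to\mathbb{R}$ is right-continuous at $x$ if for every $\epsilon>0$ there is some $\delta>0$ such that $|f(x)-f(y)|<\epsilon$ for all $y$ with $x<y<x+\delta$; it is right-continuous if this holds at every $x\in\mathbb{R}$. For $A,B\subseteq\mathbb{R}$, $A\preceq B$ means that there is a function $h\colon\mathbb{R}\to\mathbb{R}$ that is a finite composition of right-continuous functions with $A=h^{-1}(B)$. $A\prec B$ means $A\preceq B$ and not $B\preceq A$; well-foundedness of $\preceq$ means that there is no infinite sequence that is strictly decreasing with respect to $\prec$. The semi-linear ordering principle $\mathsf{SLO}$ for a relation $\preceq$ on a class of subsets of an ambient set $X$ states that for all sets $A$ and $B$ in this class, $A\preceq B$ or $B\preceq X\setminus A$. A subset of ${}^\omega\omega$ is determined if the associated infinite two-player perfect-information game on $\omega$ (Gale–Stewart game) has a winning strategy for one of the players. *)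

(* Defs.v *)
From mathcomp Require Import all_boot all_order all_algebra.
From mathcomp Require Import all_classical all_reals all_analysis.
Import Order.TTheory GRing.Theory Num.Theory.
Import numFieldNormedType.Exports.

Set Implicit Arguments.
Unset Strict Implicit.
Unset Printing Implicit Defensive.

Local Open Scope classical_set_scope.
Local Open Scope ring_scope.

Definition is_metric (R : realType) (T : Type) (d : T -> T -> R) : Prop :=
  [/\ forall x y, 0 <= d x y,
      forall x y, d x y = 0 <-> x = y,
      forall x y, d x y = d y x &
      forall x y z, d x z <= d x y + d y z].

Definition metric_compatible (R : realType) (T : topologicalType)
    (d : T -> T -> R) : Prop :=
  forall (x : T) (A : set T),
    nbhs x A <-> exists2 e : R, 0 < e & [set y | d x y < e] `<=` A.

Definition metric_complete (R : realType) (T : topologicalType)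
    (d : T -> T -> R) : Prop :=
  forall u : nat -> T,
    (forall e : R, 0 < e ->
       exists N : nat, forall m n, (N <= m)%N -> (N <= n)%N ->
         d (u m) (u n) < e) ->
    exists l : T, u @ \oo --> l.

Definition separable (T : topologicalType) : Prop :=
  exists2 D : set T, countable D & dense D.

(* The compatible complete metric is not part of the data. *)
Definition polish (R : realType) (T : topologicalType) : Prop :=
  separable T /\
  exists d : T -> T -> R,
    [/\ is_metric d, metric_compatible d & metric_complete d].

Definition borel_set (T : topologicalType) : set (set T) := <<s @open T >>.

Definition borel_measurable (S T : topologicalType) (f : S -> T) : Prop :=
  forall B : set T, borel_set B -> borel_set (f @^-1` B).

Definition baire_space : topologicalType := {ptws nat -> nat}.

(* In a run x player I plays the even-indexed moves of x and player II the
   odd-indexed ones; I wins the game with payoff set A iff A x.  A strategy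
   maps a position, i.e. the finite sequence mkseq x n of all moves made so
   far, to the next move. *)
Definition follows_I (s : seq nat -> nat) (x : baire_space) : Prop :=
  forall n : nat, ~~ odd n -> x n = s (mkseq x n).

Definition follows_II (s : seq nat -> nat) (x : baire_space) : Prop :=
  forall n : nat, odd n -> x n = s (mkseq x n).

Definition determined (A : set baire_space) : Prop :=
  (exists s : seq nat -> nat, forall x, follows_I s x -> A x) \/
  (exists s : seq nat -> nat, forall x, follows_II s x -> ~ A x).

Inductive rc_composition (R : realType) : (R -> R) -> Prop :=
| rc_single (f : R -> R) : right_continuous f -> rc_composition f
| rc_comp (f g : R -> R) :
    right_continuous f -> rc_composition g -> rc_composition (f \o g).

Definition rc_reducible (R : realType) (A B : set R) : Prop :=
  exists2 h : R -> R, rc_composition h & A = h @^-1` B.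

Definition strict_part (T : Type) (le : T -> T -> Prop) (x y : T) : Prop :=
  le x y /\ ~ le y x.

Definition SLO (X : Type) (le : set X -> set X -> Prop) (K : set (set X)) :
    Prop :=
  forall A B : set X, K A -> K B -> le A B \/ le B (~` A).

Definition wellfounded_on (T : Type) (le : T -> T -> Prop) (K : set T) : Prop :=
  ~ exists u : nat -> T,
      (forall n, K (u n)) /\ (forall n, strict_part le (u n.+1) (u n)).

(* Main.v *)
(* Greedy binary expansion [digits : R -> Baire space] is right-continuous and
   has a continuous left inverse [decode].  Hence a continuous reduction [phi]
   of [decode^-1 A] to [decode^-1 B] yields the single right-continuous
   reduction [decode \o phi \o digits] of [A] to [B], and Wadge's lemma gives
   SLO.  For well-foundedness, a strictly descending sequence [u] satisfies
   neither [u n <= u n.+1] nor [u n <= ~ u n.+1], so that player I wins both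
   Wadge games, with winning strategies [psi n b].  As in the Martin-Monk
   argument, composing them along [z : nat -> bool] yields a set of such [z]
   whose membership changes whenever a single bit of [z] is flipped.  A
   Banach-Mazur game on such a set is undetermined by strategy stealing. *)

Require Import Defs.
From mathcomp Require Import all_boot all_order all_algebra.
From mathcomp Require Import all_classical all_reals all_analysis.
From mathcomp Require Import lra.
Import Order.TTheory GRing.Theory Num.Theory.
Import numFieldNormedType.Exports.

Set Implicit Arguments.
Unset Strict Implicit.
Unset Printing Implicit Defensive.

Local Open Scope classical_set_scope.
Local Open Scope ring_scope.

(** * The Baire space as a Polish space *)

Lemma ex_half_pow_lt (R : realType) (e : R) : 0 < e -> exists n, 2 ^- n < e.
Proof.
move=> e0; exists (Num.bound e^-1).
have lt := @upper_nthrootP R e^-1 _ (leqnn _).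
by rewrite -[ltRHS]invrK ltf_pV2 // posrE ?invr_gt0 ?exprn_gt0.
Qed.

Definition cylinder (x : nat -> nat) (n : nat) : set baire_space :=
  [set y | forall i, (i < n)%N -> x i = y i].

Lemma cylinder_le (x : nat -> nat) (m n : nat) :
  (m <= n)%N -> cylinder x n `<=` cylinder x m.
Proof. by move=> mn y xy i im; apply/xy/(leq_trans im). Qed.

Lemma nbhs_cylinder (x : baire_space) (A : set baire_space) :
  nbhs x A <-> exists n, cylinder x n `<=` A.
Proof.
split; last first.
  case=> n xnA; apply: filterS xnA _.
  have -> : cylinder x n = [set y : baire_space | forall i : 'I_n, y i = x i].
    apply/seteqP; split=> [y xy i|y xy i ltin]; first exact/esym/xy.
    by have /esym := xy (Ordinal ltin).
  apply: (@filter_forall _ 'I_n (fun i y => y i = x i) (nbhs x)) => i.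
  exact: (@proj_continuous nat (fun=> nat) i x [set x i] (discrete_set1 _)).
(* The product topology is a supremum of initial topologies, so convergence of the cylinder filter
   to [x] can be checked one coordinate at a time. *)
pose F := filter_from setT (cylinder x).
have FF : Filter F.
  apply: filter_fromT_filter; first by exists 0.
  move=> i j; exists (maxn i j) => y xy.
  by split; apply: cylinder_le xy; rewrite ?leq_maxl ?leq_maxr.
suff Fx : F --> x by move=> /Fx[n _ xnA]; exists n.
apply/cvg_sup => i A'; rewrite nbhsE => -[_ [[V _ <-] Vx] VA].
by exists i.+1 => // y xy; apply: VA; rewrite /preimage/= -(xy i).
Qed.

Section baire_metric.
Variable R : realType.
Implicit Types x y z : nat -> nat.

Definition baire_dist x y : R :=
  if pselect (exists n, x n != y n) is left xy then 2 ^- ex_minn xy else 0.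

Lemma baire_dist_ge0 x y : 0 <= baire_dist x y.
Proof.
by rewrite /baire_dist; case: pselect => // h; rewrite invr_ge0 exprn_ge0.
Qed.

Lemma half_pow_le (m n : nat) : (m <= n)%N -> 2 ^- n <= 2 ^- m :> R.
Proof.
by move=> mn; rewrite lef_pV2 ?posrE ?exprn_gt0// ler_weXn2l// ler1n.
Qed.

Lemma baire_distP x y n :
  (forall i, (i < n)%N -> x i = y i) <-> baire_dist x y <= 2 ^- n.
Proof.
rewrite /baire_dist; case: pselect => [h|h]; last first.
  split=> [_|_ i _]; first by rewrite invr_ge0 exprn_ge0.
  by apply: contra_notP h => /eqP xy; exists i.
case: ex_minnP => k xyk kmin; split=> [xy|].
  by apply: half_pow_le; rewrite leqNgt; apply: contra xyk => /xy ->.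
rewrite lef_pV2 ?posrE ?exprn_gt0// ler_eXn2l ?ltr1n// => nk i lin.
by apply/eqP; apply: contraTT lin => /kmin ki; rewrite -leqNgt (leq_trans nk).
Qed.

Lemma baire_dist_eq0 x y : baire_dist x y = 0 <-> x = y.
Proof.
split=> [xy0|->]; last first.
  by rewrite /baire_dist; case: pselect => // h; exfalso; case: h => n /eqP.
apply/funext => i; apply: ((baire_distP x y i.+1).2 _ i) => //.
by rewrite xy0 invr_ge0 exprn_ge0.
Qed.

Lemma baire_dist_val x y :
  baire_dist x y = 0 \/ exists n, baire_dist x y = 2 ^- n.
Proof. by rewrite /baire_dist; case: pselect; [right; eexists|left]. Qed.

Lemma baire_distC x y : baire_dist x y = baire_dist y x.
Proof.
wlog suff le : x y / baire_dist x y <= baire_dist y x.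
  by apply/eqP; rewrite eq_le !le.
have [/baire_dist_eq0 ->//|[n yx]] := baire_dist_val y x.
rewrite yx; apply/baire_distP => i lin.
by apply/esym/((baire_distP y x n).2 _ i lin); rewrite yx.
Qed.

Lemma baire_distD x y z : baire_dist x z <= baire_dist x y + baire_dist y z.
Proof.
wlog xyz : x y z / baire_dist x y <= baire_dist y z.
  move=> wl; have [/wl//|/ltW] := leP (baire_dist x y) (baire_dist y z).
  rewrite baire_distC (baire_distC x) => /wl; rewrite baire_distC addrC.
  by rewrite (baire_distC x z).
(* The ultrametric inequality holds: the larger distance alone is an upper bound. *)
rewrite (@le_trans _ _ (baire_dist y z)) ?lerDr ?baire_dist_ge0//.
have [/baire_dist_eq0 yz|[n yz]] := baire_dist_val y z.
  by move: xyz; rewrite yz.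
rewrite yz in xyz *; apply/baire_distP => i lin.
by rewrite ((baire_distP x y n).2 xyz)// ((baire_distP y z n).2)// yz.
Qed.

Lemma polish_baire : polish R baire_space.
Proof.
split.
  (* The eventually zero sequences are countable and dense. *)
  exists (range (fun s : seq nat => nth 0%N s : baire_space)).
    exact: (card_le_trans (card_image_le _ _) (countableP _)).
  move=> U [x Ux]; rewrite openE => /(_ x Ux)/nbhs_cylinder[n xnU].
  exists (nth 0%N (mkseq x n)); split; last by exists (mkseq x n).
  by apply: xnU => i lin; rewrite nth_mkseq.
exists baire_dist; split.
- by split; [exact: baire_dist_ge0|exact: baire_dist_eq0|exact: baire_distC|
             exact: baire_distD].
- move=> x A; split=> [/nbhs_cylinder[n xnA]|[e e0 eA]].
    exists (2 ^- n); first by rewrite invr_gt0 exprn_gt0.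
    by move=> y /= xy; apply: xnA; apply/baire_distP/ltW.
  have [n ne] := ex_half_pow_lt e0; apply/nbhs_cylinder; exists n => y xy.
  by apply: eA; apply: le_lt_trans ne; apply/baire_distP.
- move=> u cu; have {}cu n : exists N, forall m, (N <= m)%N -> u m n = u N n.
    have [|N uN] := cu (2 ^- n.+1); first by rewrite invr_gt0 exprn_gt0.
    exists N => m Nm; apply: ((baire_distP _ _ n.+1).2 _ n) => //.
    exact/ltW/uN.
  (* The limit takes the value at which each coordinate stabilises. *)
  have /choice[N uN] := cu; exists (fun n => u (N n) n) => A.
  move=> /nbhs_cylinder[k kA].
  exists (\max_(i < k) N i)%N => // m /= km; apply: kA => i lik.
  by rewrite -(uN i m)// (leq_trans _ km)// (leq_bigmax (Ordinal lik)).
Qed.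

End baire_metric.

(** * Greedy binary expansions *)

Section dyadic_coding.
Variable R : realType.
Implicit Types (s t : nat -> nat) (x y : R) (m n : nat).

(** Entry 0 codes an integer, read as 0 if the code is invalid; any nonzero later entry counts as
    the bit 1. Thus every sequence codes a real. *)
Fixpoint dyadic s n : R :=
  if n is m.+1 then dyadic s m + (if s m.+1 == 0%N then 0 else 2 ^- m.+1)
  else (odflt (0 : int) (unpickle (s 0%N)))%:~R.

Definition decode s : R := sup (range (dyadic s)).

Lemma eq_dyadic s t n :
  (forall i, (i <= n)%N -> s i = t i) -> dyadic s n = dyadic t n.
Proof.
elim: n => [|n IHn] st /=; first by rewrite st.
by rewrite IHn ?st// => i ilen; apply/st/leqW.
Qed.

Lemma half_powS n : 2 ^- n = 2 ^- n.+1 + 2 ^- n.+1 :> R.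
Proof.
by rewrite exprS invfM -mulrDl -[2^-1]div1r -splitr mul1r.
Qed.

(** Each bit selects the left or right half of the current interval of length [2 ^- n], so the
    intervals are nested. *)
Lemma dyadic_itv s n k :
  dyadic s n <= dyadic s (k + n) /\
  dyadic s (k + n) + 2 ^- (k + n) <= dyadic s n + 2 ^- n.
Proof.
elim: k => [|k [IH1 IH2]]; first by rewrite add0n.
have h : 0 < 2 ^- (k + n).+1 :> R by rewrite invr_gt0 exprn_gt0.
rewrite addSn /=; rewrite half_powS in IH2.
by case: ifP => _; split; lra.
Qed.

Lemma decode_itv s n : dyadic s n <= decode s <= dyadic s n + 2 ^- n.
Proof.
have ub : ubound (range (dyadic s)) (dyadic s n + 2 ^- n).
  move=> _ [m _ <-]; have h k : 0 < 2 ^- k :> R by rewrite invr_gt0 exprn_gt0.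
  have [mn|/ltnW nm] := leqP m n.
    by have [] := dyadic_itv s m (n - m); rewrite subnK//; have := h n; lra.
  by have [] := dyadic_itv s n (m - n); rewrite subnK//; have := h m; lra.
apply/andP; split.
  by apply: ub_le_sup; [exists (dyadic s n + 2 ^- n)|exists n].
by apply: ge_sup => //; exists (dyadic s 0), 0%N.
Qed.

Lemma decode_close s t n :
  (forall i, (i <= n)%N -> s i = t i) -> `|decode s - decode t| <= 2 ^- n.
Proof.
move=> /eq_dyadic st; rewrite ler_norml.
have := decode_itv s n; have := decode_itv t n; rewrite st.
by move=> /andP[? ?] /andP[? ?]; apply/andP; split; lra.
Qed.

(** The largest multiple of [2 ^- n] that is at most [x]. *)
Fixpoint approx x n : R :=
  if n is m.+1 then
    approx x m + (if approx x m + 2 ^- m.+1 <= x then 2 ^- m.+1 else 0)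
  else (Num.floor x)%:~R.

(* Greediness makes every digit locally constant to the right. *)
Definition digits x n : nat :=
  if n is m.+1 then nat_of_bool (approx x m + 2 ^- m.+1 <= x)
  else pickle (Num.floor x).

Lemma dyadic_digits x n : dyadic (digits x) n = approx x n.
Proof.
elim: n => [|n /= ->]; first by rewrite /= pickleK.
by case: (_ <= x).
Qed.

Lemma approx_itv x n : approx x n <= x < approx x n + 2 ^- n.
Proof.
elim: n => [|n /andP[IH1 IH2]] /=.
  by have := floor_itv x; rewrite expr0 invr1 intrD.
rewrite half_powS in IH2; have [le|gt] := leP (approx x n + 2 ^- n.+1) x.
  by apply/andP; split; lra.
by apply/andP; split; lra.
Qed.

Lemma digitsK x : decode (digits x) = x.
Proof.
apply/eqP; rewrite -subr_eq0 -normr_le0; apply/ler_addgt0Pr => e e0.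
have [n /ltW ne] := ex_half_pow_lt e0; rewrite add0r (le_trans _ ne)//.
have /andP[] := decode_itv (digits x) n; have /andP[] := approx_itv x n.
rewrite dyadic_digits ler_norml => ? ? ? ?; by apply/andP; split; lra.
Qed.

Lemma digits_near_right x n :
  exists2 e, 0 < e & forall y, x <= y < x + e ->
    forall i, (i <= n)%N -> digits x i = digits y i.
Proof.
elim: n => [|n [e e0 IHn]].
  exists ((Num.floor x)%:~R + 1 - x).
    by have /andP[_] := approx_itv x 0; rewrite /= expr0 invr1 subr_gt0.
  move=> y /andP[xy ye] i; rewrite leqn0 => /eqP-> /=; congr (pickle _).
  apply/esym/eqP; rewrite floor_eq intrD.
  by have /andP[] := floor_itv x; move=> ? ?; apply/andP; split; lra.
(* [d] is the gap up to the next threshold. If it is positive, the new digit is 0 and stays so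
   within [d]; otherwise the digit is 1 and stays 1 as [x] grows. *)
pose d := approx x n + 2 ^- n.+1 - x.
exists (if 0 < d then Num.min e d else e).
  by case: ifP => // d0; rewrite lt_min e0.
move=> y /andP[xy ye] i.
have {}IHn : forall i, (i <= n)%N -> digits x i = digits y i.
  apply: IHn; rewrite xy (lt_le_trans ye)// lerD2l.
  by case: ifP => // _; rewrite ge_min lexx.
have approx_xy : approx x n = approx y n.
  by rewrite -!dyadic_digits (eq_dyadic IHn).
rewrite leq_eqVlt => /predU1P[->|/IHn//] /=.
rewrite -approx_xy; congr nat_of_bool.
move: ye; rewrite /d; case: (leP (approx x n + 2 ^- n.+1) x) => xle.
  by rewrite (le_trans xle xy).
rewrite subr_gt0 xle => ye; apply/esym/negbTE; rewrite -ltNge.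
have := ye; rewrite -ltrBlDl lt_min => /andP[_]; rewrite /d; lra.
Qed.

End dyadic_coding.

(** * Causal and continuous maps of the Baire space *)

Definition causal (phi : (nat -> nat) -> nat -> nat) : Prop :=
  forall x y n, (forall i, (i <= n)%N -> x i = y i) -> phi x n = phi y n.

Lemma right_continuous_causal (R : realType) phi :
  causal phi -> right_continuous (@decode R \o phi \o @digits R).
Proof.
move=> cphi x; apply/cvgrPdist_lt => e e0.
have [n ne] := ex_half_pow_lt e0; have [d d0 xd] := digits_near_right x n.
near=> y; apply: le_lt_trans ne; apply: decode_close => i ilen /=.
apply: cphi => j jlei; apply: xd; last exact: leq_trans ilen.
apply/andP; split; near: y; first exact: nbhs_right_ge.
by apply: nbhs_right_lt; rewrite ltrDl.
Unshelve. all: by end_near. Qed.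

(** Continuity on the Baire space, stated for one output entry at a time. *)
Definition finitary (F : (nat -> nat) -> nat -> nat) : Prop :=
  forall x n, exists m, forall y, cylinder x m y -> F x n = F y n.

Lemma finitary_prefix F x n : finitary F ->
  exists m, forall y, cylinder x m y -> forall i, (i <= n)%N -> F x i = F y i.
Proof.
move=> fF; have /choice[m xm] := fF x.
exists (\max_(i < n.+1) m i)%N => y xy i ilen; apply: xm; apply: cylinder_le xy.
exact: (@leq_bigmax _ (fun j : 'I_n.+1 => m j) (Ordinal (ilen : (i < n.+1)%N))).
Qed.

Lemma open_borel_measurable (S T : topologicalType) (f : S -> T) :
  (forall U, open U -> open (f @^-1` U)) -> borel_measurable f.
Proof.
move=> fo B; rewrite -[f @^-1` B]setTI; move: B.
apply: smallest_sub; first exact/sigma_algebra_image/smallest_sigma_algebra.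
by move=> U oU; apply: sub_sigma_algebra; rewrite setTI; exact: fo.
Qed.

Lemma borel_measurable_decode (R : realType) F : finitary F ->
  borel_measurable (fun x : baire_space => @decode R (F x)).
Proof.
move=> fF; apply: open_borel_measurable => U; rewrite !openE => oU x /= /oU.
move=> /nbhs_ballP[e /= e0 eU].
have [n ne] := ex_half_pow_lt e0; have [m xm] := finitary_prefix x n fF.
apply/nbhs_cylinder; exists m => y /xm xy; apply: eU.
by apply: le_lt_trans ne; exact: decode_close.
Qed.

(** * Strategies *)

Lemma eq_mkseq (x y : nat -> nat) n :
  (forall i, (i < n)%N -> x i = y i) -> mkseq x n = mkseq y n.
Proof.
by move=> xy; apply/eq_in_map => i; rewrite mem_iota => /andP[_]; exact: xy.
Qed.

Section recursive_sequence.
Implicit Types F : seq nat -> nat.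

(** Building the list of earlier values makes course-of-values recursion structural. *)
Fixpoint play_prefix F n : seq nat :=
  if n is m.+1 then rcons (play_prefix F m) (F (play_prefix F m)) else [::].

Definition play F n : nat := F (play_prefix F n).

Lemma play_prefixE F n : play_prefix F n = mkseq (play F) n.
Proof. by elim: n => //= n IHn; rewrite mkseqS -IHn. Qed.

Lemma playE F n : play F n = F (mkseq (play F) n).
Proof. by rewrite -play_prefixE. Qed.

Lemma eq_play F G n : (forall p, (size p <= n)%N -> F p = G p) ->
  forall i, (i <= n)%N -> play F i = play G i.
Proof.
move=> FG; elim/ltn_ind => i IHi ilen; rewrite !playE.
rewrite (@eq_mkseq _ (play G)); first by apply: FG; rewrite size_mkseq.
by move=> j ji; apply: IHi => //; apply: leq_trans (ltnW ji) ilen.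
Qed.

End recursive_sequence.

Definition evens (x : nat -> nat) n := x n.*2.
Definition odds (x : nat -> nat) n := x n.*2.+1.

(* The run in which the opponent of a player using [s] plays [y]; [b] is
   the parity of the positions at which [s] moves. *)
Definition response (b : bool) (s : seq nat -> nat) (y : nat -> nat) :
  nat -> nat :=
  play (fun p => if odd (size p) == b then s p else y (size p)./2).

Lemma responseE b s y n :
  response b s y n =
    if odd n == b then s (mkseq (response b s y) n) else y n./2.
Proof. by rewrite {1}/response playE size_mkseq. Qed.

(** The opponent's move [y i] is made at position [i.*2 + ~~ b], and no position depends on later
    moves. *)
Lemma eq_response b s x y n :
  (forall i, (i.*2 + ~~ b <= n)%N -> x i = y i) ->
  response b s x n = response b s y n.
Proof.
move=> xy; apply: (eq_play _ (leqnn n)) => p pn; case: ifP => // /negbT pb.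
apply: xy; rewrite (leq_trans _ pn)// -[leqRHS]odd_double_half addnC leq_add2r.
by case: (odd _) pb; case: b.
Qed.

Lemma follows_I_response s y : follows_I s (response false s y).
Proof. by move=> n /negbTE nodd; rewrite responseE nodd. Qed.

Lemma follows_II_response s y : follows_II s (response true s y).
Proof. by move=> n nodd; rewrite responseE nodd. Qed.

Lemma odds_response s y : odds (response false s y) = y.
Proof.
by apply/funext => n; rewrite /odds responseE /= odd_double /= uphalf_double.
Qed.

Lemma evens_response s y : evens (response true s y) = y.
Proof.
by apply/funext => n; rewrite /evens responseE odd_double /= doubleK.
Qed.

(** Player I moves first, so a strategy for I answers before seeing the opponent's entry of the same
    index; this delay lets infinite compositions converge. *)
Definition strictly_causal (phi : (nat -> nat) -> nat -> nat) : Prop :=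
  forall x y n, (forall i, (i < n)%N -> x i = y i) -> phi x n = phi y n.

Lemma strictly_causalW phi : strictly_causal phi -> causal phi.
Proof. by move=> cphi x y n xy; apply: cphi => i /ltnW; exact: xy. Qed.

Lemma strictly_causal_response s :
  strictly_causal (fun y => evens (response false s y)).
Proof.
move=> x y n xy; apply: eq_response => i.
by rewrite addn1 ltn_double; exact: xy.
Qed.

Lemma causal_response s : causal (fun y => odds (response true s y)).
Proof.
move=> x y n xy; apply: eq_response => i; rewrite addn0 => /half_leq.
by rewrite doubleK /= uphalf_double; exact: xy.
Qed.

(** * Infinite compositions of strictly causal maps *)

Section cascade.
Variable psi : nat -> bool -> (nat -> nat) -> nat -> nat.
Hypothesis psi_causal : forall n b, strictly_causal (psi n b).
Implicit Type z : nat -> bool.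

Fixpoint cascade_approx z k n : nat -> nat :=
  if k is k'.+1 then psi n (z n) (cascade_approx z k' n.+1) else fun=> 0%N.

(** Each strictly causal map fixes one more entry, so after [k] maps the first [k] entries no longer
    depend on the zero seed. *)
Lemma cascade_approx_stable z k l n i : (i < k)%N -> (i < l)%N ->
  cascade_approx z k n i = cascade_approx z l n i.
Proof.
elim: k l n i => // k IHk [//|l] n i ik il; apply: psi_causal => j ji.
by apply: IHk; [apply: leq_trans ji _|apply: leq_trans ji _].
Qed.

(* As [psi] is strictly causal, the equations [x_n = psi n (z n) x_{n+1}]
   determine the sequences [x_n]. *)
Definition cascade z n : nat -> nat := fun i => cascade_approx z i.+1 n i.

Lemma cascadeE z n : cascade z n = psi n (z n) (cascade z n.+1).
Proof.
by apply/funext => i; apply: psi_causal => j ji; apply: cascade_approx_stable.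
Qed.

Lemma eq_cascade_approx z z' k n :
  (forall i, (n <= i < n + k)%N -> z i = z' i) ->
  cascade_approx z k n = cascade_approx z' k n.
Proof.
elim: k n => //= k IHk n zz'; rewrite IHk => [|i /andP[ni ik]]; last first.
  by apply: zz'; rewrite (ltnW ni) addnS -addSn.
by rewrite zz'// leqnn addnS ltnS leq_addr.
Qed.

Lemma eq_cascade z z' n :
  (forall i, (n <= i)%N -> z i = z' i) -> cascade z n = cascade z' n.
Proof.
move=> zz'; apply/funext => i.
by rewrite /cascade (@eq_cascade_approx z z')// => j /andP[/zz'].
Qed.

End cascade.

(** * Undetermined flip sets *)

Section concatenation.
Implicit Types x y : nat -> nat.

(** A move of the Banach-Mazur game. The separate head makes every number code a nonempty word, so
    that infinitely many moves yield an infinite sequence. *)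
Definition word (k : nat) : seq bool :=
  let: (b, s) := odflt (false, [::]) (unpickle k) in b :: s.

Lemma word_pickle b s : word (pickle (b, s)) = b :: s.
Proof. by rewrite /word pickleK. Qed.

Lemma size_word_gt0 k : (0 < size (word k))%N.
Proof. by rewrite /word; case: (odflt _ _). Qed.

Definition words x n : seq bool := flatten (map word (mkseq x n)).

Definition concat x i : bool := nth false (words x i.+1) i.

Lemma leq_size_words x n : (n <= size (words x n))%N.
Proof.
elim: n => // n IHn; rewrite /words mkseqS map_rcons flatten_rcons size_cat.
by rewrite -addn1 leq_add ?size_word_gt0.
Qed.

Lemma wordsD x m n :
  words x (m + n) = words x m ++ words (fun i => x (m + i)%N) n.
Proof.
rewrite /words -flatten_cat -map_cat /mkseq iotaD map_cat add0n.
by rewrite -[in iota m n](addn0 m) iotaDl -[in LHS]map_comp.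
Qed.

Lemma concatE x n i : (i < size (words x n))%N ->
  concat x i = nth false (words x n) i.
Proof.
move=> ilt; rewrite /concat; have ilt' := leq_size_words x i.+1.
have [le|/ltnW le] := leqP i.+1 n.
  by rewrite -[in RHS](subnKC le) wordsD nth_cat ilt'.
by rewrite -[in LHS](subnKC le) wordsD nth_cat ilt.
Qed.

Definition scons (a : nat) x (n : nat) : nat := if n is m.+1 then x m else a.

Lemma mkseq_scons a x n : mkseq (scons a x) n.+1 = a :: mkseq x n.
Proof. by rewrite /mkseq /= -(addn0 1%N) iotaDl -map_comp. Qed.

Lemma concat_scons a x i :
  concat (scons a x) i =
    if (i < size (word a))%N then nth false (word a) i
    else concat x (i - size (word a)).
Proof.
have E n : words (scons a x) n.+1 = word a ++ words x n.
  by rewrite /words mkseq_scons.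
have [lt|ge] := ltnP i (size (word a)).
  by rewrite (@concatE _ 1) E ?size_cat ?(leq_trans lt) ?leq_addr// nth_cat lt.
rewrite (@concatE _ i.+2) E; last first.
  by rewrite size_cat (leq_trans (leq_size_words x i.+1)) ?leq_addl.
rewrite nth_cat ltnNge ge /=; apply/esym/concatE.
exact: leq_ltn_trans (leq_subr _ _) (leq_size_words x i.+1).
Qed.

Definition differ_once (z z' : nat -> bool) : Prop :=
  exists m, z m = ~~ z' m /\ forall i, i != m -> z i = z' i.

Lemma differ_once_scons a x y :
  differ_once (concat x) (concat y) ->
  differ_once (concat (scons a x)) (concat (scons a y)).
Proof.
move=> [m [xym xy]]; exists (size (word a) + m)%N; split=> [|i im].
  by rewrite !concat_scons ltnNge leq_addr /= addKn.
rewrite !concat_scons; case: ltnP => // ai; apply: xy.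
by apply: contra im => /eqP<-; rewrite subnKC.
Qed.

(** Both sides spell one bit, then [word u], then [concat x]. On the right [word u] is absorbed into
    the opening move, which shifts the turns by one. *)
Lemma differ_once_merge (u : nat) x :
  differ_once (concat (scons (pickle (false, [::] : seq bool)) (scons u x)))
              (concat (scons (pickle (true, word u)) x)).
Proof.
exists 0%N; split; first by rewrite !concat_scons !word_pickle.
move=> [//|i] _; rewrite concat_scons word_pickle /= subSS subn0.
by rewrite !concat_scons word_pickle /= ltnS subSS.
Qed.

(** The first [m] bits of [concat x] depend only on the first [m] words. *)
Lemma finitary_concat (F : (nat -> bool) -> nat -> nat) :
  (forall z n, exists m, forall z', (forall i, (i < m)%N -> z i = z' i) ->
     F z n = F z' n) ->
  finitary (F \o concat).
Proof.
move=> fF x n; have [m zm] := fF (concat x) n; exists m => y xy; apply: zm.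
move=> i im; rewrite /concat /words (@eq_mkseq x y)// => j ji.
by apply: xy; apply: leq_trans ji im.
Qed.

(* Strategy stealing: the answer [t 0] to the move [false] in the first run is
   appended to the move [true] that opens the second one; from then on each
   run supplies the opponent's moves of the other. *)
Lemma twin_runs (s : seq nat -> nat) :
  exists x y, [/\ follows_II s x, follows_II s y &
                  differ_once (concat x) (concat y)].
Proof.
pose e0 := pickle (false, [::] : seq bool).
pose e1 k := pickle (true, word k).
(* The runs are [e0, t 0, t 1, ...] and [e1 (t 0), t 1, t 2, ...]; [s] supplies the even entries of
   [t] in the first and the odd entries in the second. *)
pose t := play (fun p => if odd (size p) then s (e1 (head 0%N p) :: behead p)
                         else s (e0 :: p)).
have tE n : t n = if odd n then s (e1 (t 0%N) :: behead (mkseq t n))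
                  else s (e0 :: mkseq t n).
  by rewrite {1}/t playE size_mkseq; case: n.
pose t' i := t i.+1.
have tS : t = scons (t 0%N) t' by apply/funext => -[].
exists (scons e0 t), (scons (e1 (t 0%N)) t'); split.
- move=> [//|n]; rewrite oddS => /negbTE nodd.
  by rewrite mkseq_scons -[LHS]/(t n) tE nodd.
- move=> [//|n] nodd; rewrite mkseq_scons -[LHS]/(t n.+1) tE nodd.
  by rewrite [in mkseq t _]tS mkseq_scons.
- by rewrite tS; exact: differ_once_merge.
Qed.

(** After the opening move [s [::]], player I is the second to move in the rest of the game. *)
Lemma twin_runs_I (s : seq nat -> nat) :
  exists x y, [/\ follows_I s x, follows_I s y &
                  differ_once (concat x) (concat y)].
Proof.
have [x [y [fx fy xy]]] := twin_runs (fun p => s (s [::] :: p)).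
exists (scons (s [::]) x), (scons (s [::]) y).
split; last exact: differ_once_scons.
  by move=> [//|n]; rewrite mkseq_scons oddS negbK; exact: fx.
by move=> [//|n]; rewrite mkseq_scons oddS negbK; exact: fy.
Qed.

(** A winning strategy would put both twin runs on the same side of [P], although they differ in one
    bit. *)
Lemma flip_set_undetermined (P : set (nat -> bool)) :
  (forall z z', differ_once z z' -> (P z <-> ~ P z')) ->
  ~ determined [set x : baire_space | P (concat x)].
Proof.
move=> flip; case=> -[s sP]; last first.
  by have [x [y [/sP /= Px /sP /= Py /flip]]] := twin_runs s; tauto.
by have [x [y [/sP /= Px /sP /= Py /flip]]] := twin_runs_I s; tauto.
Qed.

End concatenation.

Lemma iff_negb (b : bool) (q : Prop) : (~~ b <-> q) <-> ~ (b <-> q).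
Proof.
have [f t] : ~ false /\ true by [].
by case: b => /=; case: (pselect q); tauto.
Qed.

Lemma iff_not_congr (p q r : Prop) : (q <-> ~ r) -> ((p <-> q) <-> ~ (p <-> r)).
Proof. by case: (pselect p); case: (pselect r); tauto. Qed.

(** * Effect of one flipped bit on a cascade *)

Section cascade_flip.
Variable psi : nat -> bool -> (nat -> nat) -> nat -> nat.
Hypothesis psi_causal : forall n b, strictly_causal (psi n b).
Variable Q : nat -> set (nat -> nat).
Hypothesis psiQ : forall n b x, Q n (psi n b x) <-> (b <-> Q n.+1 x).

(** Let [m] be the flipped bit. The sequence at stage [m.+1] is unchanged, so membership flips at
    stage [m]; equal bits below [m] carry the flip down to stage 0. *)
Lemma cascade_flip z z' :
  differ_once z z' -> (Q 0%N (cascade psi z 0) <-> ~ Q 0%N (cascade psi z' 0)).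
Proof.
move=> [m [zm zz']].
suff H n : (n <= m)%N ->
    (Q (m - n)%N (cascade psi z (m - n)) <->
     ~ Q (m - n)%N (cascade psi z' (m - n))).
  by have := H m (leqnn m); rewrite subnn.
elim: n => [_|n IHn nm].
  rewrite subn0 (cascadeE psi_causal z) (cascadeE psi_causal z') zm.
  rewrite (@eq_cascade psi z z' m.+1); last first.
    by move=> i mi; apply: zz'; rewrite gtn_eqF.
  by rewrite !psiQ; exact: iff_negb.
have {IHn} := IHn (ltnW nm); rewrite -(subnSK nm) => IHn.
rewrite (cascadeE psi_causal z) (cascadeE psi_causal z') !psiQ zz'.
  exact: iff_not_congr.
by rewrite ltn_eqF// ltn_subrL (leq_trans _ nm).
Qed.

End cascade_flip.

(** * Reductions by right-continuous functions *)

Lemma rc_comp_trans (R : realType) (f g : R -> R) :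
  rc_composition f -> rc_composition g -> rc_composition (f \o g).
Proof.
elim=> [h rch|h h' rch _ IH] rcg; first exact: rc_comp.
by apply: (rc_comp rch); exact: IH.
Qed.

Lemma rc_reducible_trans (R : realType) (A B D : set R) :
  rc_reducible A B -> rc_reducible B D -> rc_reducible A D.
Proof.
by move=> [f rcf ->] [g rcg ->]; exists (g \o f) => //; exact: rc_comp_trans.
Qed.

Lemma rc_reducibleC (R : realType) (A B : set R) :
  rc_reducible A B -> rc_reducible (~` A) (~` B).
Proof. by move=> [f rcf ->]; exists f. Qed.

Lemma rc_reducible_causal (R : realType) (A B : set R) phi : causal phi ->
  (forall x, A (decode R x) <-> B (decode R (phi x))) -> rc_reducible A B.
Proof.
move=> cphi AB; exists (@decode R \o phi \o @digits R).
  by apply: rc_single; exact: right_continuous_causal.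
apply/seteqP; split=> x.
  by rewrite -{1}(digitsK x) => /AB.
by move=> /AB; rewrite digitsK.
Qed.

(** * Wadge games in a determined class *)

Section determined_class.
Variables (R : realType) (C : forall T : topologicalType, set (set T)).
Hypothesis C_polish : forall (T : topologicalType) (A : set T),
  C A -> polish R T.
Hypothesis C_setC : forall (T : topologicalType) (A : set T), C A -> C (~` A).
Hypothesis C_bigcup : forall (T : topologicalType) (A : nat -> set T),
  (forall n, C (A n)) -> C (\bigcup_n A n).
Hypothesis C_preimage : forall (S T : topologicalType) (f : S -> T) (A : set T),
  polish R S -> polish R T -> borel_measurable f -> C A -> C (f @^-1` A).
Hypothesis C_determined :
  forall A : set baire_space, C A -> determined A.
Implicit Types A B : set R.

Lemma C_setU (T : topologicalType) (A B : set T) : C A -> C B -> C (A `|` B).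
Proof.
move=> CA CB.
have -> : A `|` B = \bigcup_n (if n is 0%N then A else B).
  apply/seteqP; split=> x; first by case; [exists 0%N|exists 1%N].
  by case=> -[|n] _; [left|right].
by apply: C_bigcup => -[].
Qed.

Lemma C_setI (T : topologicalType) (A B : set T) : C A -> C B -> C (A `&` B).
Proof.
move=> CA CB; rewrite -[A `&` B]setCK setCI.
by apply/C_setC/C_setU; exact: C_setC.
Qed.

Lemma C_decode A F : C A -> finitary F ->
  C [set x : baire_space | A (decode R (F x))].
Proof.
move=> CA fF; apply: (C_preimage _ _ (borel_measurable_decode fF) CA).
  exact: polish_baire.
exact: C_polish CA.
Qed.

(** In the Wadge game I plays a code for [A] and II a code for [B]. A winning strategy for II is a
    reduction; one for I gives [psi]. *)
Lemma wadge_dichotomy A B : C A -> C B ->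
  rc_reducible A B \/
  exists2 psi, strictly_causal psi &
    forall x, A (decode R (psi x)) <-> ~ B (decode R x).
Proof.
move=> CA CB.
have CA' : C [set x : baire_space | A (decode R (evens x))].
  by apply: C_decode => // x n; exists n.*2.+1 => y; exact.
have CB' : C [set x : baire_space | B (decode R (odds x))].
  by apply: C_decode => // x n; exists n.*2.+2 => y; exact.
(* Player I wins when exactly one of the two memberships holds. *)
have [[s sW]|[s sW]] := C_determined (C_setU (C_setI CA' (C_setC CB'))
                                             (C_setI (C_setC CA') CB')).
- right; exists (fun y => evens (response false s y)).
    exact: strictly_causal_response.
  move=> y; have := sW _ (follows_I_response s y).
  by rewrite /= odds_response; tauto.
- left; apply: (rc_reducible_causal (@causal_response s)) => y.
  have := sW _ (follows_II_response s y); rewrite /= evens_response.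
  have [|] := pselect (A (decode R y));
  by have [|] := pselect (B (decode R (odds (response true s y)))); tauto.
Qed.

Lemma SLO_rc_reducible : SLO (@rc_reducible R) (@C R).
Proof.
move=> A B CA CB; have [|[psi cpsi AB]] := wadge_dichotomy CA CB; first by left.
right; apply: (rc_reducible_causal (strictly_causalW cpsi)) => x /=.
by have := AB x; case: (pselect (B (decode R x))); tauto.
Qed.

Lemma wellfounded_rc_reducible : wellfounded_on (@rc_reducible R) (@C R).
Proof.
move=> [u [Cu dec]].
have /choice[psi psiP] : forall n,
    exists psi : bool -> (nat -> nat) -> nat -> nat,
    forall b, strictly_causal (psi b) /\
      forall x, u n (decode R (psi b x)) <-> (b <-> u n.+1 (decode R x)).
  move=> n; have [le_u nle_u] := dec n.
  (* Otherwise [u n] reduces to the complement of [u n.+1], this to the complement of [u n], and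
     that to [u n.+1]. *)
  have nle_uC : ~ rc_reducible (u n) (~` u n.+1).
    move=> h; apply: nle_u; apply: (rc_reducible_trans h).
    apply: (rc_reducible_trans (rc_reducibleC le_u)).
    by have := rc_reducibleC h; rewrite setCK.
  have [//|[p0 cp0 p0P]] := wadge_dichotomy (Cu n) (Cu n.+1).
  have [//|[p1 cp1 p1P]] := wadge_dichotomy (Cu n) (C_setC (Cu n.+1)).
  (* [p0] negates membership; [p1], from the game against the complement, preserves it. *)
  exists (fun b => if b then p1 else p0) => -[]; split=> // x.
    have t : true by [].
    have := p1P x; rewrite /setC /=.
    by case: (pselect (u n.+1 (decode R x))); tauto.
  have f : ~ false by [].
  by have := p0P x; tauto.
pose P : set (nat -> bool) := [set z | u 0%N (decode R (cascade psi z 0))].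
have cpsi n b := (psiP n b).1.
apply: (@flip_set_undetermined P).
  apply: (cascade_flip cpsi (Q := fun n x => u n (decode R x))) => n b x.
  exact: (psiP n b).2.
apply: C_determined; apply: C_decode (Cu 0%N) _.
apply: (finitary_concat (F := fun z => cascade psi z 0)) => z n.
(* Entry [n] of the cascade is computed from the bits [0] to [n] of [z]. *)
exists n.+1 => z' zz'; rewrite /cascade; congr (_ n).
by apply: eq_cascade_approx => i; rewrite add0n => /zz'.
Qed.

End determined_class.

Theorem theorem8p2 (R : realType)
  (C : forall T : topologicalType, set (set T))
  (C_polish : forall (T : topologicalType) (A : set T), C T A -> polish R T)
  (C_nonempty : exists (T : topologicalType) (A : set T), C T A)
  (C_setC : forall (T : topologicalType) (A : set T), C T A -> C T (~` A))
  (C_bigcup : forall (T : topologicalType) (A : nat -> set T),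
     (forall n, C T (A n)) -> C T (\bigcup_n A n))
  (C_preimage : forall (S T : topologicalType) (f : S -> T) (A : set T),
     polish R S -> polish R T -> borel_measurable f ->
     C T A -> C S (f @^-1` A))
  (C_determined : forall A : set baire_space, C baire_space A -> determined A) :
  SLO (@rc_reducible R) (C R) /\ wellfounded_on (@rc_reducible R) (C R).
Proof.
by split; [exact: SLO_rc_reducible C_determined|
           exact: wellfounded_rc_reducible C_determined].
Qed.
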